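(* Let $(A,[\cdot,\cdot])$ be a left-Alia algebra with a representation $(l,r,V)$. Let $T:V\to A$ be a linear map and let $T_\sharp\in V^*\otimes A\subset(A\oplus V^* )\otimes(A\oplus V^* )$ be given by $$\langle T_\sharp,u\otimes a^*\rangle=\langle T(u),a^*\rangle,\qquad\forall u\in V,\ a^*\in A^*.$$ Then $T_\sharp-\tau(T_\sharp)$ is an antisymmetric solution of the left-Alia Yang-Baxter equation in the left-Alia algebra $A\ltimes_{l^*,l^*-r^*}V^*$ if and only if $T$ is a relative Rota-Baxter operator of $(A,[\cdot,\cdot])$ associated to $(l,r,V)$.
   Context: All vector spaces are finite-dimensional over an algebraically closed field $\mathbb K$ of characteristic zero. A left-Alia algebra is a vector space $A$ with a bilinear map $[\cdot,\cdot]:A\times A\to A$ (not assumed antisymmetric) such that for all $x,y,z\in A$ $$[[x,y],z]+[[y,z],x]+[[z,x],y]=[[y,x],z]+[[z,y],x]+[[x,z],y].$$ A representation of $(A,[\cdot,\cdot])$ is a triple $(l,r,V)$ with $V$ a vector space and $l,r:A\to\mathrm{End}(V)$ linear maps such that for all $x,y\in A$ $$l([x,y])-l([y,x])=r(x)r(y)-r(y)r(x)+r(y)l(x)-r(x)l(y).$$ Given a representation, $A\ltimes_{l,r}V$ is the left-Alia algebra $A\oplus V$ with bracket $[x+u,y+v]_d=[x,y]+l(x)v+r(y)u$. For a linear map $l:A\to\mathrm{End}(V)$, $l^*:A\to\mathrm{End}(V^* )$ is defined by $\langle l^*(x)u^*,v\rangle=-\langle u^*,l(x)v\rangle$. If $(l,r,V)$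 is a representation then so is $(l^*,l^*-r^*,V^* )$. A linear map $T:V\to A$ is a relative Rota-Baxter operator of $(A,[\cdot,\cdot])$ associated to $(l,r,V)$ if $[T(u),T(v)]=T\big(l(Tu)v+r(Tv)u\big)$ for all $u,v\in V$. For a left-Alia algebra $(B,[\cdot,\cdot])$ and $s=\sum_i u_i\otimes v_i\in B\otimes B$, put $$\mathrm{Al}(s)=\sum_{i,j}\Big([u_i,u_j]\otimes v_i\otimes v_j+u_i\otimes([u_j,v_i]-[v_i,u_j])\otimes v_j-u_i\otimes u_j\otimes[v_j,v_i]\Big)\in B^{\otimes 3}.$$ $s$ is a solution of the left-Alia Yang-Baxter equation in $B$ if $\mathrm{Al}(s)=0$, and antisymmetric if $s+\tau(s)=0$, where $\tau(x\otimes y)=y\otimes x$. *)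

(* Defs.v *)
From HB Require Import structures.
From mathcomp Require Import all_boot all_algebra.
Set Implicit Arguments.
Unset Strict Implicit.
Unset Printing Implicit Defensive.
Import GRing.Theory.
Local Open Scope ring_scope.

Definition dual (K : fieldType) (V : vectType K) : Type := 'Hom(V, K^o).
HB.instance Definition _ (K : fieldType) (V : vectType K) :=
  Vector.copy (dual V) 'Hom(V, K^o).
Identity Coercion dual_hom : dual >-> hom.

(* The universal property is stated on decompositions: decomp_in chooses one   *)
(* for each tensor, and lift_in says that a bilinear beta takes the same value *)
(* on every decomposition, hence factors through tens_in (see tlift).          *)
Record tensorProduct (K : fieldType) (B C : vectType K) := TensorProduct {
  tensor_sort :> vectType K;
  tens_in : {bilinear B -> C -> tensor_sort};
  decomp_in : tensor_sort -> seq (B * C);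
  decomp_inK : forall s, \sum_(p <- decomp_in s) tens_in p.1 p.2 = s;
  lift_in : forall (W : vectType K) (beta : B -> C -> W),
    bilinear_for *:%R *:%R beta -> forall ps : seq (B * C),
    \sum_(p <- decomp_in (\sum_(q <- ps) tens_in q.1 q.2)) beta p.1 p.2
    = \sum_(p <- ps) beta p.1 p.2
}.

Section TensorExistence.
Variables (K : fieldType) (B C : vectType K).

Definition pure_fun (x : B) (y : C) (f : dual B) : C := (f x : K) *: y.

Lemma pure_fun_linear x y : linear (pure_fun x y).
Proof.
by move=> a f g; rewrite /pure_fun add_lfunE scale_lfunE scalerDl scalerA.
Qed.

HB.instance Definition _ x y :=
  GRing.isLinear.Build K (dual B) C *:%R (pure_fun x y) (pure_fun_linear x y).

Definition pure (x : B) (y : C) : 'Hom(dual B, C) := linfun (pure_fun x y).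

Lemma pureE x y (f : dual B) : pure x y f = (f x : K) *: y.
Proof. by rewrite lfunE. Qed.

Lemma pure_bilinear : bilinear_for *:%R *:%R pure.
Proof.
split=> [y a x x' | x a y y']; apply/lfunP => f;
  rewrite add_lfunE scale_lfunE !pureE.
  by rewrite linearP scalerDl scalerA.
by rewrite scalerDr !scalerA mulrC.
Qed.

HB.instance Definition _ :=
  bilinear_isBilinear.Build K B C 'Hom(dual B, C) *:%R *:%R pure pure_bilinear.

End TensorExistence.

Section Tensor.
Variable K : fieldType.
Implicit Types A B C D E V W : vectType K.

Definition dbasis B (i : 'I_(\dim {:B})) : dual B :=
  linfun (coord (vbasis {:B}) i : B -> K^o).

Lemma dbasisE B i (x : B) : dbasis i x = coord (vbasis {:B}) i x.
Proof. by rewrite lfunE. Qed.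

Lemma dual_sum B (f : dual B) :
  f = \sum_(i < \dim {:B}) (f (vbasis {:B})`_i : K) *: dbasis i.
Proof.
apply/lfunP => x; rewrite sum_lfunE {1}(coord_vbasis (memvf x)) linear_sum.
by apply: eq_bigr => i _; rewrite linearZ scale_lfunE dbasisE /= [LHS]mulrC.
Qed.

Definition pure_decomp B C (s : 'Hom(dual B, C)) : seq (B * C) :=
  [seq ((vbasis {:B})`_i, s (dbasis i)) | i : 'I_(\dim {:B})].

Lemma pure_decompK B C (s : 'Hom(dual B, C)) :
  \sum_(p <- pure_decomp s) pure p.1 p.2 = s.
Proof.
apply/lfunP => f; rewrite big_image /= sum_lfunE.
rewrite [in RHS](dual_sum f) linear_sum.
by apply: eq_bigr => i _; rewrite pureE linearZ.
Qed.

Lemma pure_lift_bilinear B C W (g : {bilinear B -> C -> W}) (ps : seq (B * C)) :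
  \sum_(p <- pure_decomp (\sum_(q <- ps) pure q.1 q.2)) g p.1 p.2
  = \sum_(p <- ps) g p.1 p.2.
Proof.
rewrite big_image /=.
transitivity (\sum_(i < \dim {:B}) \sum_(p <- ps)
    g (coord (vbasis {:B}) i p.1 *: (vbasis {:B})`_i) p.2).
  apply: eq_bigr => i _; rewrite sum_lfunE linear_sumr.
  by apply: eq_bigr => p _; rewrite pureE dbasisE linearZr_LR linearZl_LR.
rewrite exchange_big; apply: eq_bigr => p _ /=.
by rewrite -linear_sumlz -(coord_vbasis (memvf p.1)).
Qed.

Lemma pure_lift B C W (beta : B -> C -> W) :
  bilinear_for *:%R *:%R beta -> forall ps : seq (B * C),
  \sum_(p <- pure_decomp (\sum_(q <- ps) pure q.1 q.2)) beta p.1 p.2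
  = \sum_(p <- ps) beta p.1 p.2.
Proof.
move=> hb; exact: (pure_lift_bilinear (HB.pack_for {bilinear B -> C -> W} beta
  (bilinear_isBilinear.Build K B C W *:%R *:%R beta hb))).
Qed.

(* Opaque: a tensor product is used only through the fields of tensorProduct. *)
Lemma tensor_product B C : tensorProduct B C.
Proof. exact: (TensorProduct (@pure_decompK B C) (@pure_lift B C)). Qed.

Definition tensor B C : vectType K := tensor_product B C.

Definition tens B C : {bilinear B -> C -> tensor B C} :=
  tens_in (tensor_product B C).
Arguments tens {B C}.

Definition tdecomp B C : tensor B C -> seq (B * C) :=
  @decomp_in _ _ _ (tensor_product B C).

Lemma tdecompK B C (s : tensor B C) :
  \sum_(p <- tdecomp s) tens p.1 p.2 = s.
Proof. exact: decomp_inK. Qed.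

(* The linear map from B (x) C to W induced by a bilinear beta. *)
Definition tlift B C W (beta : B -> C -> W) (s : tensor B C) : W :=
  \sum_(p <- tdecomp s) beta p.1 p.2.

Lemma tlift_sum B C W (beta : B -> C -> W) (ps : seq (B * C)) :
  bilinear_for *:%R *:%R beta ->
  tlift beta (\sum_(p <- ps) tens p.1 p.2) = \sum_(p <- ps) beta p.1 p.2.
Proof. by move=> hb; apply: lift_in. Qed.

Lemma tlift_tens B C W (beta : B -> C -> W) (x : B) (y : C) :
  bilinear_for *:%R *:%R beta -> tlift beta (tens x y) = beta x y.
Proof. by move/(tlift_sum [:: (x, y)]); rewrite !big_seq1. Qed.

Lemma tlift_linear B C W (beta : B -> C -> W) :
  bilinear_for *:%R *:%R beta -> linear (tlift beta).
Proof.
move=> hb; pose g : {bilinear B -> C -> W} :=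
  HB.pack beta (bilinear_isBilinear.Build K B C W *:%R *:%R beta hb).
move=> a s t.
rewrite -[s in LHS]tdecompK -[t in LHS]tdecompK scaler_sumr.
pose ps := [seq (a *: p.1, p.2) | p <- tdecomp s] ++ tdecomp t.
transitivity (tlift beta (\sum_(p <- ps) tens p.1 p.2)).
  rewrite big_cat big_map /=; congr (tlift _ (_ + _)).
  by apply: eq_bigr => p _; rewrite linearZl_LR.
rewrite tlift_sum // big_cat big_map scaler_sumr /=; congr (_ + _).
by apply: eq_bigr => p _; rewrite -[LHS]/(g _ _) linearZl_LR.
Qed.

Definition tswap B C : tensor B C -> tensor C B :=
  tlift (fun x y => tens y x).

Definition tmap B C D E (f : B -> D) (g : C -> E) : tensor B C -> tensor D E :=
  tlift (fun x y => tens (f x) (g y)).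

(* <xi (x) a, u (x) alpha> = xi(u) alpha(a), see tpair_tens. *)
Definition tpair V A (s : tensor (dual V) A) (t : tensor V (dual A)) : K :=
  tlift (fun (xi : dual V) (a : A) =>
    tlift (fun (u : V) (alpha : dual A) => xi u * alpha a : K^o) t) s.

Definition antisymmetric_tensor B (s : tensor B B) : Prop := s + tswap s = 0.

Lemma tswap_tens B C (x : B) (y : C) : tswap (tens x y) = tens y x.
Proof.
by apply: tlift_tens; split=> [z a u v | z a u v]; rewrite ?linearPl ?linearPr.
Qed.

Lemma tmap_tens B C D E (f : {linear B -> D}) (g : {linear C -> E}) x y :
  tmap f g (tens x y) = tens (f x) (g y).
Proof.
by apply: (@tlift_tens _ _ _ (fun x y => tens (f x) (g y)));
  split=> [z a u v | z a u v]; rewrite linearP ?linearPl ?linearPr.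
Qed.

Lemma tpairE V A (s : tensor (dual V) A) (u : V) (alpha : dual A) :
  tpair s (tens u alpha) =
  tlift (fun (xi : dual V) (a : A) => xi u * alpha a : K^o) s.
Proof.
apply: eq_bigr => p _.
apply: (@tlift_tens _ _ _ (fun u (alpha : dual A) => p.1 u * alpha p.2 : K^o)).
split=> [z a v w | z a v w].
  by rewrite linearP mulrDl -mulrA.
by rewrite add_lfunE scale_lfunE mulrDr; congr (_ + _); apply: mulrCA.
Qed.

Lemma eval_bilinear V A (u : V) (alpha : dual A) :
  bilinear_for *:%R *:%R (fun (xi : dual V) (a : A) => xi u * alpha a : K^o).
Proof.
split=> [z c v w | z c v w].
  by rewrite add_lfunE scale_lfunE mulrDl -mulrA.
by rewrite linearP mulrDr; congr (_ + _); apply: mulrCA.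
Qed.

Lemma tpair_tens V A (xi : dual V) (a : A) (u : V) (alpha : dual A) :
  tpair (tens xi a) (tens u alpha) = xi u * alpha a.
Proof. by rewrite tpairE (tlift_tens _ _ (eval_bilinear u alpha)). Qed.

Lemma dual_separates A (a b : A) :
  (forall alpha : dual A, alpha a = alpha b) -> a = b.
Proof.
move=> ab; rewrite (coord_vbasis (memvf a)) (coord_vbasis (memvf b)).
by apply: eq_bigr => i _; rewrite -!dbasisE ab.
Qed.

Lemma tensor_dualE A V (s : tensor (dual V) A) :
  s = \sum_i tens (dbasis i)
        (\sum_(p <- tdecomp s) (p.1 (vbasis {:V})`_i : K) *: p.2).
Proof.
rewrite -[LHS]tdecompK.
under [RHS]eq_bigr do rewrite linear_sumr.
rewrite exchange_big; apply: eq_bigr => p _ /=.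
rewrite {1}(dual_sum p.1) linear_sumlz.
by apply: eq_bigr => i _; rewrite linearZl_LR linearZr_LR.
Qed.

Lemma sharp_exists_unique A V (T : {linear V -> A}) :
  exists! s : tensor (dual V) A,
    forall (u : V) (alpha : dual A), tpair s (tens u alpha) = alpha (T u).
Proof.
pose ps := [seq (dbasis i, T (vbasis {:V})`_i) | i : 'I_(\dim {:V})].
have psE u (alpha : dual A) :
    tpair (\sum_(p <- ps) tens p.1 p.2) (tens u alpha) = alpha (T u).
  rewrite tpairE tlift_sum; last exact: eval_bilinear.
  rewrite big_image /= [in RHS](coord_vbasis (memvf u)) !linear_sum.
  by apply: eq_bigr => i _; rewrite dbasisE !linearZ.
exists (\sum_(p <- ps) tens p.1 p.2); split=> // s sE.
rewrite [LHS]tensor_dualE [RHS]tensor_dualE; apply: eq_bigr => i _.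
congr (tens _ _); apply: dual_separates => alpha.
move: (psE (vbasis {:V})`_i alpha) (sE (vbasis {:V})`_i alpha).
rewrite !tpairE => e1 e2; move: (etrans e1 (esym e2)).
rewrite !linear_sum /tlift => e; under eq_bigr do rewrite linearZ.
by under [RHS]eq_bigr do rewrite linearZ.
Qed.

End Tensor.
Arguments tens {K B C}.

Record leftAlia (K : fieldType) := LeftAlia {
  alia_sort :> vectType K;
  bracket : {bilinear alia_sort -> alia_sort -> alia_sort};
  alia_identity : forall x y z : alia_sort,
    bracket (bracket x y) z + bracket (bracket y z) x + bracket (bracket z x) y
    = bracket (bracket y x) z + bracket (bracket z y) x + bracket (bracket x z) y
}.

(* The linear maps l, r : A -> End(V) are given as bilinear maps A -> V -> V. *)
Record representation (K : fieldType) (A : leftAlia K) (V : vectType K) :=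
  Representation {
    rep_l : {bilinear A -> V -> V};
    rep_r : {bilinear A -> V -> V};
    rep_axiom : forall (x y : A) (v : V),
      rep_l (bracket A x y) v - rep_l (bracket A y x) v =
      rep_r x (rep_r y v) - rep_r y (rep_r x v)
      + rep_r y (rep_l x v) - rep_r x (rep_l y v)
  }.

Section Constructions.
Variable K : fieldType.

Section Semidirect.
Variables (A : leftAlia K) (V : vectType K) (rho : representation A V).

Definition semidirect_bracket (p q : A * V) : A * V :=
  (bracket A p.1 q.1, rep_l rho p.1 q.2 + rep_r rho q.1 p.2).

Lemma semidirect_bilinear : bilinear_for *:%R *:%R semidirect_bracket.
Proof.
split=> [q a p p' | p a q q']; rewrite /semidirect_bracket /= ?linearPl ?linearPr.
  by rewrite [X in (_, X)]addrACA -scalerDr.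
by rewrite [X in (_, X)]addrACA -scalerDr.
Qed.

HB.instance Definition _ :=
  bilinear_isBilinear.Build K (A * V)%type (A * V)%type (A * V)%type
    *:%R *:%R semidirect_bracket semidirect_bilinear.

Lemma rep_axiomE (x y : A) (v : V) (l := rep_l rho) (r := rep_r rho) :
  l (bracket A x y) v + r x (l y v) + r y (r x v)
  = l (bracket A y x) v + r x (r y v) + r y (l x v).
Proof.
have /eqP := rep_axiom rho x y v.
rewrite subr_eq => /eqP ->.
by rewrite [LHS](ACl (5*1*3*4*6*2*7)) /= !subrK.
Qed.

Lemma semidirect_identity (x y z : A * V) (b := semidirect_bracket) :
  b (b x y) z + b (b y z) x + b (b z x) y
  = b (b y x) z + b (b z y) x + b (b x z) y.
Proof.
case: x y z => [x u] [y v] [z w]; rewrite /b /semidirect_bracket /=.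
congr pair => /=; first exact: alia_identity.
rewrite !(linearDl, linearDr) !addrA /=.
rewrite [LHS](AC 9 ((1*5*9)*(4*8*3)*(7*2*6))) /= !rep_axiomE.
by rewrite !addrA [LHS](ACl (1*6*8*4*9*2*7*3*5)).
Qed.

Definition semidirect : leftAlia K :=
  @LeftAlia K (A * V)%type semidirect_bracket semidirect_identity.

End Semidirect.

Section DualRepresentation.
Variables (A : leftAlia K) (V : vectType K).

Implicit Types f g : {bilinear A -> V -> V}.

Definition dual_action (f : A -> V -> V) (x : A) (xi : dual V) : dual V :=
  - (xi \o linfun (f x))%VF.

Lemma dual_actionE f x xi v : dual_action f x xi v = - xi (f x v).
Proof. by rewrite /dual_action opp_lfunE comp_lfunE lfunE. Qed.

Lemma dual_action_bilinear f : bilinear_for *:%R *:%R (dual_action f).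
Proof.
split=> [xi a x y | x a xi eta]; apply/lfunP => v;
  rewrite add_lfunE scale_lfunE !dual_actionE.
  by rewrite linearPl linearP opprD scalerN.
by rewrite add_lfunE scale_lfunE opprD scalerN.
Qed.

HB.instance Definition _ f :=
  bilinear_isBilinear.Build K A (dual V) (dual V) *:%R *:%R
    (dual_action f) (dual_action_bilinear f).

Definition dual_action_sub (f g : A -> V -> V) (x : A) (xi : dual V) : dual V :=
  dual_action f x xi - dual_action g x xi.

Lemma dual_action_subE f g x xi v :
  dual_action_sub f g x xi v = xi (g x v) - xi (f x v).
Proof.
rewrite /dual_action_sub add_lfunE (opp_lfunE (dual_action g x xi)).
by rewrite !dual_actionE opprK addrC.
Qed.

Lemma dual_action_sub_bilinear f g :
  bilinear_for *:%R *:%R (dual_action_sub f g).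
Proof.
split=> [xi a x y | x a xi eta]; rewrite /dual_action_sub ?linearPl ?linearPr;
  by rewrite /= opprD addrACA -scalerBr.
Qed.

HB.instance Definition _ f g :=
  bilinear_isBilinear.Build K A (dual V) (dual V) *:%R *:%R
    (dual_action_sub f g) (dual_action_sub_bilinear f g).

Variable rho : representation A V.

Lemma dual_rep_axiom (x y : A) (xi : dual V) (l := dual_action (rep_l rho))
    (r := dual_action_sub (rep_l rho) (rep_r rho)) :
  l (bracket A x y) xi - l (bracket A y x) xi =
  r x (r y xi) - r y (r x xi) + r y (l x xi) - r x (l y xi).
Proof.
have lE y1 eta v : l y1 eta v = - eta (rep_l rho y1 v) by exact: dual_actionE.
have rE y1 eta v :
  r y1 eta v = eta (rep_r rho y1 v) - eta (rep_l rho y1 v).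
  exact: dual_action_subE.
move: l r lE rE => l r lE rE.
apply/lfunP => v; rewrite !(add_lfunE, opp_lfunE, lE, rE).
have := congr1 xi (rep_axiom rho x y v).
rewrite linearB linearB linearD linearB /= => e.
apply: oppr_inj; rewrite -opprD opprK e.
rewrite !opprB !opprD !opprK !addrA.
by rewrite [RHS](ACl (10*3*6*7*4*1*2*5*8*12*11*9)) /= !addrK.
Qed.

Definition dual_rep : representation A (dual V) :=
  @Representation K A (dual V) (dual_action (rep_l rho))
    (dual_action_sub (rep_l rho) (rep_r rho)) dual_rep_axiom.

End DualRepresentation.

Definition relative_RB (A : leftAlia K) (V : vectType K)
    (rho : representation A V) (T : {linear V -> A}) : Prop :=
  forall u v : V,
    bracket A (T u) (T v) = T (rep_l rho (T u) v + rep_r rho (T v) u).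

Section YangBaxter.
Variable B : leftAlia K.

Definition Al_term (p q : B * B) : tensor B (tensor B B) :=
  tens (bracket B p.1 q.1) (tens p.2 q.2)
  + tens p.1 (tens (bracket B q.1 p.2 - bracket B p.2 q.1) q.2)
  - tens p.1 (tens q.1 (bracket B q.2 p.2)).

Definition Al_seq (ps : seq (B * B)) : tensor B (tensor B B) :=
  \sum_(p <- ps) \sum_(q <- ps) Al_term p q.

(* Independent of the chosen decomposition of s, see AlE. *)
Definition Al (s : tensor B B) : tensor B (tensor B B) := Al_seq (tdecomp s).

Definition aliaYBE (s : tensor B B) : Prop := Al s = 0.

Lemma linD (W : vectType K) a (x y z t : W) :
  (a *: x + y) + (a *: z + t) = a *: (x + z) + (y + t).
Proof. by rewrite addrACA scalerDr. Qed.

Lemma linB (W : vectType K) a (x y z t : W) :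
  (a *: x + y) - (a *: z + t) = a *: (x - z) + (y - t).
Proof. by rewrite opprD addrACA scalerBr. Qed.

Lemma Al_term_bilinearl q :
  bilinear_for *:%R *:%R (fun u v => Al_term (u, v) q).
Proof.
by split=> [v a u u' | u a v v']; rewrite /Al_term /=;
  do ?rewrite ?linearPl ?linearPr ?linB; rewrite linD linB.
Qed.

Lemma Al_term_bilinearr p :
  bilinear_for *:%R *:%R (fun u v => Al_term p (u, v)).
Proof.
by split=> [v a u u' | u a v v']; rewrite /Al_term /=;
  do ?rewrite ?linearPl ?linearPr ?linB; rewrite linD linB.
Qed.

Lemma AlE ps : Al (\sum_(p <- ps) tens p.1 p.2) = Al_seq ps.
Proof.
rewrite /Al /Al_seq; set s := \sum_(p <- ps) _.
transitivity (\sum_(p <- tdecomp s) \sum_(q <- ps) Al_term p q).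
  apply: eq_bigr => p _.
  transitivity (tlift (fun u v => Al_term p (u, v)) s).
    by apply: eq_bigr => -[].
  rewrite tlift_sum; last exact: Al_term_bilinearr.
  by apply: eq_bigr => -[].
rewrite exchange_big [RHS]exchange_big; apply: eq_bigr => q _ /=.
transitivity (tlift (fun u v => Al_term (u, v) q) s).
  by apply: eq_bigr => -[].
rewrite tlift_sum; last exact: Al_term_bilinearl.
by apply: eq_bigr => -[].
Qed.

End YangBaxter.

(* Tensor product of the two inclusions into A + dual V; see tincl_tens. *)
Definition tincl (A : leftAlia K) (V : vectType K)
    (rho : representation A (dual V)) (s : tensor (dual V) A) :
    tensor (semidirect rho) (semidirect rho) :=
  tmap (fun xi : dual V => (0, xi) : semidirect rho)
       (fun a : A => (a, 0) : semidirect rho) s.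

Lemma tincl_tens (A : leftAlia K) (V : vectType K)
    (rho : representation A (dual V)) (xi : dual V) (a : A) :
  tincl rho (tens xi a) = tens ((0, xi) : semidirect rho) ((a, 0) : semidirect rho).
Proof.
rewrite /tincl /tmap tlift_tens //; split=> [b c x y | x c b d] /=.
  rewrite -linearPl; congr (tens _ _).
  by apply: injective_projections => //=; rewrite scaler0 addr0.
rewrite -linearPr; congr (tens _ _).
by apply: injective_projections => //=; rewrite scaler0 addr0.
Qed.

End Constructions.

(* Main.v *)
From HB Require Import structures.
Require Import Defs.
From mathcomp Require Import all_boot all_algebra ring.
Set Implicit Arguments.
Unset Strict Implicit.
Unset Printing Implicit Defensive.
Import GRing.Theory.
Local Open Scope ring_scope.

(** A tensor in [B (x) (B (x) B)] vanishes as soon as all triples of linear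
    forms [f], [g], [h] kill it ([contract_separates], [dual_separates]), so
    the Yang-Baxter equation can be tested on such triples.  Write [S f] for
    the contraction of the first factor of [s] with [f].  When [s] is
    antisymmetric, contracting its second factor with [f] gives [- S f], and
    the triple evaluates [Al s] to
      [f [S g, S h] + g ([S f, S h] - [S h, S f]) - h [S g, S f]]
    ([contract_Al]).  This expression no longer involves a decomposition of
    [s] into pure tensors.

    In the semidirect product of [A] and [dual V], a linear form is a pair
    [(alpha, u)] of a form on [A] and a vector of [V], because [V] is reflexive
    ([sum_dual_surj]).  For [s] the skew-symmetrization of [Tsharp], the
    contraction is [S (alpha, u) = (T u, - alpha o T)] ([contract_skew_sharp]).
    Let [D u v = [T u, T v] - T (l (T u) v + r (T v) u)] measure the failure of
    the Rota-Baxter identity.  Substituting [S] above, with [f], [g], [h] equal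
    to [(alpha, u)], [(beta, v)], [(gamma, w)], everything collapses to
      [alpha (D v w) + beta (D u w - D w u) - gamma (D v u)]
    ([contract_Al_skew_sharp]).  This vanishes identically when [D] does, and
    conversely taking [beta = gamma = 0] recovers [D = 0]. *)

(** * Contraction and swap of tensors *)

Section Contraction.
Variable K : fieldType.
Implicit Types B C : vectType K.

Definition contract B C (f : dual B) : tensor B C -> C :=
  tlift (fun x y => (f x : K) *: y).

Lemma contract_bilinear B C (f : dual B) :
  bilinear_for *:%R *:%R (fun (x : B) (y : C) => (f x : K) *: y).
Proof.
split=> [y a x x' | x a y y'] /=.
  by rewrite linearP scalerDl scalerA.
by rewrite scalerDr !scalerA mulrC.
Qed.

HB.instance Definition _ B C (f : dual B) :=
  GRing.isLinear.Build K (tensor B C) C *:%R (@contract B C f)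
    (tlift_linear (contract_bilinear C f)).

Lemma contract_tens B C (f : dual B) (x : B) (y : C) :
  contract f (tens x y) = (f x : K) *: y.
Proof. exact: tlift_tens (contract_bilinear C f). Qed.

(** Expanding the left factors in a basis writes [t] as the sum of the
    [b_i (x) contract b_i^* t]. *)
Lemma contract_separates B C (t : tensor B C) :
  (forall f : dual B, contract f t = 0) -> t = 0.
Proof.
move=> t0; rewrite -(tdecompK t).
transitivity (\sum_(i < \dim {:B})
    tens (vbasis {:B})`_i (contract (dbasis i) t)).
  under [RHS]eq_bigr do rewrite linear_sumr.
  rewrite exchange_big; apply: eq_bigr => p _ /=.
  rewrite {1}(coord_vbasis (memvf p.1)) linear_sumlz.
  by apply: eq_bigr => i _; rewrite linearZl_LR linearZr_LR dbasisE.
by rewrite big1 // => i _; rewrite t0 linear0r.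
Qed.

Lemma tswap_linear B C : linear (@tswap K B C).
Proof.
apply: tlift_linear.
by split=> [z a u v | z a u v]; rewrite ?linearPl ?linearPr.
Qed.

HB.instance Definition _ B C :=
  GRing.isLinear.Build K (tensor B C) (tensor C B) *:%R (@tswap K B C)
    (@tswap_linear B C).

Lemma tswapK B C (s : tensor B C) : tswap (tswap s) = s.
Proof.
rewrite -[s in LHS]tdecompK -[RHS]tdecompK.
rewrite (linear_sum (@tswap K B C)) (linear_sum (@tswap K C B)).
by apply: eq_bigr => p _; rewrite /= !tswap_tens.
Qed.

Lemma contract_tswap B C (f : dual C) (s : tensor B C) :
  contract f (tswap s) = \sum_(p <- tdecomp s) (f p.2 : K) *: p.1.
Proof.
rewrite -[s in LHS]tdecompK (linear_sum (@tswap K B C)).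
rewrite (linear_sum (contract f)); apply: eq_bigr => p _.
by rewrite /= tswap_tens contract_tens.
Qed.

Lemma antisymmetrization B (s : tensor B B) : antisymmetric_tensor (s - tswap s).
Proof.
by rewrite /antisymmetric_tensor linearB /= tswapK addrA subrK subrr.
Qed.

End Contraction.

(** * The Yang-Baxter equation of an antisymmetric tensor *)

Section YangBaxterForm.
Variables (K : fieldType) (B : leftAlia K).

Lemma dual_bracket_sums (I : Type) (ps : seq I) (k : dual B) (a b : I -> K)
    (x y : I -> B) :
  k (bracket B (\sum_(p <- ps) a p *: x p) (\sum_(q <- ps) b q *: y q))
  = \sum_(p <- ps) \sum_(q <- ps) a p * b q * k (bracket B (x p) (y q)).
Proof.
rewrite linear_sumlz linear_sum; apply: eq_bigr => p _.
rewrite linear_sumr linear_sum; apply: eq_bigr => q _.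
by rewrite linearZl_LR linearZr_LR !linearZ /= [LHS]mulrA.
Qed.

Lemma contract3 (f g h : dual B) (x y z : B) :
  h (contract g (contract f (tens x (tens y z)))) = f x * g y * h z.
Proof.
by rewrite contract_tens linearZ /= contract_tens !linearZ /= [LHS]mulrA.
Qed.

(** In each summand of [Al s] one form meets a bracket of two factors of [s]
    and the other two forms are paired with the remaining factors.  Summing
    turns the factors in the bracket into contractions, with a sign for each
    form that was paired with a second factor. *)
Lemma contract_Al (s : tensor B B) (f g h : dual B) :
  antisymmetric_tensor s ->
  let S (k : dual B) := contract k s in
  h (contract g (contract f (Al s)))
  = f (bracket B (S g) (S h)) + g (bracket B (S f) (S h) - bracket B (S h) (S f))
    - h (bracket B (S g) (S f)).
Proof.
move=> s_anti S.
have flip (k : dual B) : \sum_(p <- tdecomp s) (k p.2 : K) *: p.1 = - S k.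
  rewrite -contract_tswap; apply/eqP; rewrite -addr_eq0 addrC /S -linearD /=.
  by rewrite s_anti linear0.
have -> : h (contract g (contract f (Al s))) =
    \sum_(p <- tdecomp s) \sum_(q <- tdecomp s)
      h (contract g (contract f (Al_term p q))).
  rewrite /Al /Al_seq (linear_sum (contract f)) (linear_sum (contract g)).
  rewrite (linear_sum h); apply: eq_bigr => p _.
  rewrite (linear_sum (contract f)) (linear_sum (contract g)).
  exact: (linear_sum h).
have e1 : f (bracket B (S g) (S h)) = \sum_(p <- tdecomp s)
    \sum_(q <- tdecomp s) g p.2 * h q.2 * f (bracket B p.1 q.1).
  by rewrite -dual_bracket_sums !flip linearNl linearNr opprK.
have e2 : g (bracket B (S f) (S h)) = - \sum_(p <- tdecomp s)
    \sum_(q <- tdecomp s) f p.1 * h q.2 * g (bracket B p.2 q.1).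
  by rewrite -dual_bracket_sums flip linearNr linearN opprK.
have e3 : g (bracket B (S h) (S f)) = - \sum_(p <- tdecomp s)
    \sum_(q <- tdecomp s) f p.1 * h q.2 * g (bracket B q.1 p.2).
  rewrite exchange_big; under eq_bigr do under eq_bigr do rewrite [f _ * _]mulrC.
  by rewrite -dual_bracket_sums flip linearNl linearN opprK.
have e4 : h (bracket B (S g) (S f)) = \sum_(p <- tdecomp s)
    \sum_(q <- tdecomp s) f p.1 * g q.1 * h (bracket B q.2 p.2).
  rewrite exchange_big; under eq_bigr do under eq_bigr do rewrite [f _ * _]mulrC.
  by rewrite -dual_bracket_sums.
rewrite linearB /= e1 e2 e3 e4 opprK addrCA -!sumrN -!big_split /=.
apply: eq_bigr => p _; rewrite -!sumrN -!big_split /=; apply: eq_bigr => q _.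
rewrite /Al_term !(linearD, linearN) /= !contract3 !linearB /=.
by ring.
Qed.

End YangBaxterForm.

(** * Linear forms on the sum of a space and a dual space *)

Section DualOfSum.
Variables (K : fieldType) (A V : vectType K).

Definition sum_form (alpha : dual A) (u : V) (p : A * dual V) : K^o :=
  alpha p.1 + p.2 u.

Lemma sum_form_linear alpha u : linear (sum_form alpha u).
Proof.
move=> a p q; rewrite /sum_form /= linearP add_lfunE scale_lfunE.
by rewrite scalerDr addrACA.
Qed.

HB.instance Definition _ alpha u :=
  GRing.isLinear.Build K (A * dual V)%type K^o *:%R (sum_form alpha u)
    (sum_form_linear alpha u).

Definition sum_dual (alpha : dual A) (u : V) : dual (A * dual V)%type :=
  linfun (sum_form alpha u).

Lemma sum_dualE alpha u x xi : sum_dual alpha u (x, xi) = alpha x + xi u.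
Proof. by rewrite lfunE. Qed.

(** Reflexivity of [V] provides [u]: its coordinates are the values of [f] on
    the dual basis. *)
Lemma sum_dual_surj (f : dual (A * dual V)%type) :
  exists alpha u, f = sum_dual alpha u.
Proof.
pose inA (x : A) : A * dual V := (x, 0).
have inA_linear : linear inA.
  by move=> a x y; apply: injective_projections; rewrite //= scaler0 addr0.
pose inAl : {linear A -> (A * dual V)%type} :=
  HB.pack inA (GRing.isLinear.Build K A (A * dual V)%type *:%R inA inA_linear).
pose e := vbasis {:V}.
exists (f \o linfun inAl)%VF, (\sum_(i < \dim {:V}) (f (0, dbasis i) : K) *: e`_i).
apply/lfunP => -[x xi]; rewrite sum_dualE comp_lfunE lfunE /= /inA.
have -> : ((x, xi) : A * dual V) = (x, 0) + (0, xi).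
  by apply: injective_projections; rewrite /= ?addr0 ?add0r.
rewrite linearD; congr (_ + _).
have -> : ((0, xi) : A * dual V) =
    \sum_(i < \dim {:V}) (xi e`_i : K) *: ((0, dbasis i) : A * dual V).
  rewrite {1}(dual_sum xi); apply: injective_projections.
    by rewrite (raddf_sum fst) /= big1 // => i _; rewrite scaler0.
  by rewrite (raddf_sum snd).
rewrite !linear_sum; apply: eq_bigr => i _.
by rewrite !linearZ /= [LHS]mulrC.
Qed.

End DualOfSum.

(** * The skew tensor of a linear map and the Rota-Baxter identity *)

Section Operator.
Variables (K : fieldType) (A : leftAlia K) (V : vectType K).
Implicit Types (rho : representation A V) (T : {linear V -> A}).

Definition skew_sharp rho (Tsharp : tensor (dual V) A) :
    tensor (semidirect (dual_rep rho)) (semidirect (dual_rep rho)) :=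
  tincl (dual_rep rho) Tsharp - tswap (tincl (dual_rep rho) Tsharp).

(** Contracting [Tsharp] on the left with [u] gives [T u], and on the right
    with [alpha] gives [alpha o T]; the sign is that of the swapped term. *)
Lemma contract_skew_sharp rho T (Tsharp : tensor (dual V) A) :
  (forall u (alpha : dual A), tpair Tsharp (tens u alpha) = alpha (T u)) ->
  forall (alpha : dual A) (u : V),
  contract (sum_dual alpha u : dual (semidirect (dual_rep rho)))
    (skew_sharp rho Tsharp) = (T u, - (alpha \o linfun T)%VF).
Proof.
move=> TsharpE alpha u; rewrite /skew_sharp linearB /=.
have {}TsharpE w (beta : dual A) :
    \sum_(p <- tdecomp Tsharp) (p.1 w * beta p.2 : K) = beta (T w).
  by rewrite -TsharpE tpairE.
have -> : tincl (dual_rep rho) Tsharp = \sum_(p <- tdecomp Tsharp)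
  tens ((0, p.1) : semidirect (dual_rep rho))
       ((p.2, 0) : semidirect (dual_rep rho)) by [].
set f := (sum_dual alpha u : dual (semidirect (dual_rep rho))).
rewrite (linear_sum (@tswap _ _ _)) !(linear_sum (contract f)) /=.
under eq_bigr do rewrite contract_tens sum_dualE linear0 add0r.
under [X in _ - X]eq_bigr do
  rewrite tswap_tens contract_tens sum_dualE zero_lfunE addr0.
apply: injective_projections; rewrite /= ?(raddf_sum fst) ?(raddf_sum snd) /=.
  rewrite [X in _ - X]big1 ?subr0 => [|i _]; last by rewrite scaler0.
  apply: dual_separates => beta; rewrite -TsharpE linear_sum.
  by apply: eq_bigr => p _; rewrite linearZ.
rewrite big1 ?sub0r => [|i _]; last by rewrite scaler0.
apply/lfunP => w; rewrite !opp_lfunE comp_lfunE lfunE -TsharpE sum_lfunE.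
by congr (- _); apply: eq_bigr => p _; rewrite scale_lfunE [LHS]mulrC.
Qed.

Definition RB_defect rho T (u v : V) : A :=
  bracket A (T u) (T v) - T (rep_l rho (T u) v + rep_r rho (T v) u).

Lemma relative_RBP rho T :
  relative_RB rho T <-> forall u v, RB_defect rho T u v = 0.
Proof.
split=> RB u v; first by rewrite /RB_defect RB subrr.
by apply/eqP; rewrite -subr_eq0; apply/eqP/RB.
Qed.

(** The forms [alpha], [beta], [gamma] enter [contract_Al] both directly and,
    composed with [T], through the dual representation.
    Collecting the occurrences of each one, the terms in [l] that do not belong
    to a defect cancel. *)
Lemma contract_Al_skew_sharp rho T (Tsharp : tensor (dual V) A)
    (B := semidirect (dual_rep rho)) (D := RB_defect rho T) :
  (forall u (alpha : dual A), tpair Tsharp (tens u alpha) = alpha (T u)) ->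
  forall (alpha beta gamma : dual A) (u v w : V),
  (sum_dual gamma w : dual B)
    (contract (sum_dual beta v : dual B)
      (contract (sum_dual alpha u : dual B)
        (Al (B := B) (skew_sharp rho Tsharp))))
  = alpha (D v w) + beta (D u w - D w u) - gamma (D v u).
Proof.
move=> TsharpE alpha beta gamma u v w.
rewrite contract_Al; last exact: antisymmetrization.
rewrite !(contract_skew_sharp rho TsharpE) linearB /=.
rewrite /bracket /= /semidirect_bracket /=.
have TE (d : dual A) x : (- (d \o linfun T)%VF) x = - d (T x).
  by rewrite opp_lfunE comp_lfunE lfunE.
have lE x d y : dual_action (rep_l rho) x (- (d \o linfun T)%VF) y
    = d (T (rep_l rho x y)).
  by rewrite dual_actionE TE opprK.
have rE x d y :
    dual_action_sub (rep_l rho) (rep_r rho) x (- (d \o linfun T)%VF) y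
    = d (T (rep_l rho x y)) - d (T (rep_r rho x y)).
  by rewrite dual_action_subE !TE opprK addrC.
(* Abstracted because add_lfunE would otherwise unfold the actions. *)
move: (dual_action_sub _ _) (dual_action _) lE rE => r l lE rE.
rewrite !sum_dualE !add_lfunE !lE !rE.
by rewrite /D /RB_defect; ring.
Qed.

End Operator.

Theorem theorem5p6 (K : closedFieldType) (charK : [pchar K] =i pred0)
    (A : leftAlia K) (V : vectType K) (rho : representation A V)
    (T : {linear V -> A}) (Tsharp : tensor (dual V) A)
    (TsharpE : forall (u : V) (alpha : dual A),
      tpair Tsharp (tens u alpha) = alpha (T u)) :
  let s := tincl (dual_rep rho) Tsharp - tswap (tincl (dual_rep rho) Tsharp) in
  (antisymmetric_tensor s /\ aliaYBE (B := semidirect (dual_rep rho)) s)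
  <-> relative_RB rho T.
Proof.
move=> s; rewrite relative_RBP.
have AlE := contract_Al_skew_sharp rho TsharpE.
split=> [[_ s_YBE] v w | D0].
  apply: dual_separates => alpha; rewrite linear0.
  have := AlE alpha 0 0 0 v w; rewrite [Al _]s_YBE !linear0 !zero_lfunE.
  by rewrite addr0 subr0.
split; first exact: antisymmetrization.
apply: contract_separates => f; apply: contract_separates => g.
apply: dual_separates => h.
have [alpha [u ->]] := sum_dual_surj f.
have [beta [v ->]] := sum_dual_surj g.
have [gamma [w ->]] := sum_dual_surj h.
by rewrite [LHS]AlE !D0 subrr !linear0 !addr0.
Qed.
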